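(* Let $[a,b]\subset\mathbb{R}$ be a compact interval with $a<b$, and let $f:[a,b]\to\mathbb{R}$ be a continuous probability density function supported on $[a,b]$. Then for every $\varepsilon>0$ there is a piecewise polynomial probability density $g$ on $[a,b]$ such that $\|f-g\|_\infty<\varepsilon$.
   Context: A probability density on $[a,b]$ is a nonnegative function $h:[a,b]\to\mathbb{R}$ with $\int_a^b h(t)\,dt=1$ (density with respect to Lebesgue measure). A function on $[a,b]$ is piecewise polynomial if there is a finite partition of $[a,b]$ into subintervals, $a=t_1<t_2<\dots<t_n=b$, such that the function coincides with a polynomial on each subinterval. $\|h\|_\infty=\sup_{x\in[a,b]}|h(x)|$ is the supremum norm on $[a,b]$. *)

(* Defs.v *)
From HB Require Import structures.
From mathcomp Require Import all_boot all_order all_algebra.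
From mathcomp Require Import all_classical all_reals all_analysis.
Set Implicit Arguments.
Unset Strict Implicit.
Unset Printing Implicit Defensive.
Import Order.TTheory GRing.Theory Num.Theory.
Import numFieldNormedType.Exports.
Local Open Scope classical_set_scope.
Local Open Scope ring_scope.

(* A function on [a, b] is represented by a function h : R -> R of which only
   the values on `[a, b] matter. *)

(* Measurability is part of being a density: the library's integral is also
   defined on nonmeasurable functions. *)
Definition prob_density (R : realType) (a b : R) (h : R -> R) : Prop :=
  [/\ measurable_fun `[a, b] h,
      forall x, x \in `[a, b] -> 0 <= h x
    & (\int[lebesgue_measure]_(x in `[a, b]) (h x)%:E = 1)%E].

(* The subintervals form a genuine partition: each interior breakpoint t i
   belongs to exactly one of the two adjacent pieces, the right one if
   c i = true and the left one if c i = false (BSide true x = BLeft x,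
   BSide false x = BRight x). So jumps at the breakpoints are allowed. The
   conditions c 0 = true and c n = false say that a and b are covered. *)
Definition piecewise_polynomial (R : realType) (a b : R) (h : R -> R) : Prop :=
  exists (n : nat) (t : nat -> R) (c : nat -> bool) (p : nat -> {poly R}),
    [/\ t 0%N = a /\ t n = b,
        c 0%N = true /\ c n = false,
        forall i, (i < n)%N -> t i < t i.+1
      & forall i, (i < n)%N -> forall x,
          x \in Interval (BSide (c i) (t i)) (BSide (c i.+1) (t i.+1)) ->
          h x = (p i).[x]].

(* Extended-real valued, so that it is +oo when h is unbounded on [a, b]; the
   real-valued sup would return 0 there. *)
Definition sup_norm (R : realType) (a b : R) (h : R -> R) : \bar R :=
  ereal_sup [set `|h x|%:E | x in `[a, b]].

(* Main.v *)
Require Import Defs.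
From HB Require Import structures.
From mathcomp Require Import all_boot all_order all_algebra.
From mathcomp Require Import all_classical all_reals all_analysis.
From mathcomp Require Import measurable_realfun lra.
Set Implicit Arguments.
Unset Strict Implicit.
Unset Printing Implicit Defensive.
Import Order.TTheory GRing.Theory Num.Theory.
Import numFieldNormedType.Exports.
Local Open Scope classical_set_scope.
Local Open Scope ring_scope.

(* By uniform continuity, f oscillates by at most eps / 2 on every piece of a
   fine enough partition of [a, b]. The step function g equal on each piece to
   the average of f there lies within eps / 2 of f; it is nonnegative and has
   the same integral as f on every piece, so it needs no normalization. *)

(** Heine-Cantor, by compactness in its near-covering form: if [P h x'] holds for all [x'] near each
    point [x] of the segment and all small [h > 0], then a single [h] serves the whole segment. *)
Lemma within_continuous_uniform (R : realType) (a b : R) (f : R -> R) (e : R) :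
  {within `[a, b], continuous f} -> 0 < e ->
  exists2 h, 0 < h & forall x y, x \in `[a, b] -> y \in `[a, b] ->
    `|x - y| <= h -> `|f x - f y| <= e.
Proof.
move=> cf e0.
(* Membership of [x] sits inside [P] because the covering argument tests [P] at all real points near
   a point of the segment, including those outside it. *)
pose P (h x : R) := x \in `[a, b] ->
  forall y, y \in `[a, b] -> `|x - y| <= h -> `|f x - f y| <= e.
have /compact_near_coveringP cov := @segment_compact R a b.
have : \forall h \near 0^'+, `[a, b] `<=` P h.
  apply: cov => x abx.
  have /subspace_continuousP /(_ x abx) /cvgrPdist_lt /(_ (e / 2)) := cf.
  rewrite divr_gt0// => /(_ isT); rewrite near_withinE => /nbhs_ballP[d /= d0 xd].
  have d20 : 0 < d / 2 by rewrite divr_gt0.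
  (* Half of the radius [d] goes to [x'] and half to [h], so any [y] within [h] of [x'] is still
     within [d] of [x]; both values are then compared with [f x], at a cost of [e / 2] each. *)
  exists (ball x (d / 2), [set h | 0 < h < d / 2]).
    split=> /=; first exact: nbhsx_ballx.
    by near=> h; apply/andP; split; near: h;
      [exact: nbhs_right_gt|exact: nbhs_right_lt].
  move=> [x' h] [/= xx' /andP[h0 hd]] abx' y aby x'y.
  have fx' : `|f x - f x'| < e / 2.
    apply: xd => //; apply: le_ball xx'.
    by rewrite ler_pdivrMr// ler_peMr ?ler1n// ltW.
  have fy : `|f x - f y| < e / 2.
    apply: xd => //; rewrite /ball/=; apply: (le_lt_trans (ler_distD x' _ _)).
    by rewrite [ltRHS]splitr ltrD// (le_lt_trans x'y).
  apply: (le_trans (ler_distD (f x) _ _)).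
  by rewrite [leRHS]splitr lerD// ltW// distrC.
move=> covh; have [h [h0 hP]] := filter_ex (filterI (nbhs_right_gt (0 : R)) covh).
by exists h => // x y abx aby; apply: (hP x).
Unshelve. all: by end_near. Qed.

(** The witness is the mean value of [f]. By monotonicity of the integral it lies between the
    minimum [f m] and the maximum [f M], and each [f x] is within [e] of both. *)
Lemma average_approx (R : realType) (a b : R) (f : R -> R) (e : R) :
  a < b -> {within `[a, b], continuous f} ->
  (forall x, x \in `[a, b] -> 0 <= f x) ->
  (forall x y, x \in `[a, b] -> y \in `[a, b] -> `|f x - f y| <= e) ->
  exists v : R, [/\ 0 <= v,
    (\int[lebesgue_measure]_(x in `[a, b]) v%:E =
     \int[lebesgue_measure]_(x in `[a, b]) (f x)%:E)%E
    & forall x, x \in `[a, b] -> `|f x - v| <= e].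
Proof.
move=> ab cf f0 fe.
have ba0 : 0 < b - a by rewrite subr_gt0.
have intf : lebesgue_measure.-integrable `[a, b] (EFin \o f).
  by apply: continuous_compact_integrable => //; exact: segment_compact.
have muab : lebesgue_measure (`[a, b]%classic : set R) = (b - a)%:E.
  by rewrite lebesgue_measure_itv/= lte_fin ab EFinB.
have int_cst r :
    (\int[lebesgue_measure]_(x in `[a, b]) r%:E = (r * (b - a))%:E)%E.
  by rewrite integral_cst// [X in (_ * X)%E]muab.
have int_cstP r : lebesgue_measure.-integrable `[a, b] (EFin \o cst r : R -> \bar R).
  apply: continuous_compact_integrable; first exact: segment_compact.
  by apply: continuous_subspaceT => x; exact: cvg_cst.
have [M abM fM] := EVT_max (ltW ab) cf.
have [m abm fm] := EVT_min (ltW ab) cf.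
set I := (\int[lebesgue_measure]_(x in `[a, b]) (f x)%:E)%E.
have IE : I = (fine I)%:E by rewrite fineK// integrable_fin_num.
have mI : f m <= fine I / (b - a).
  rewrite ler_pdivlMr// -lee_fin -IE -int_cst.
  apply: le_integral => //; first exact: (int_cstP _).
  by move=> x; rewrite inE => abx; rewrite lee_fin fm.
have MI : fine I / (b - a) <= f M.
  rewrite ler_pdivrMr// -lee_fin -IE -int_cst.
  apply: le_integral => //; first exact: (int_cstP _).
  by move=> x; rewrite inE => abx; rewrite lee_fin fM.
exists (fine I / (b - a)); split=> [||x abx].
- exact: le_trans (f0 _ abm) mI.
- by rewrite int_cst IE divfK// gt_eqF.
- have := fe _ _ abx abM; have := fe _ _ abx abm.
  rewrite !ler_norml => /andP[_ xm] /andP[Mx _]; apply/andP; split.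
  + by rewrite (le_trans Mx)// lerB.
  + by rewrite (le_trans _ xm)// lerB.
Qed.

Lemma piecewise_polynomial_cst (R : realType) (a b v : R) :
  a < b -> piecewise_polynomial a b (cst v).
Proof.
move=> ab; exists 1%N, (fun i => if i is 0%N then a else b),
  (fun i => i == 0%N), (fun=> v%:P).
by split=> // [[]//|i _ x _]; rewrite hornerC.
Qed.

(** The strict test [x < m] gives the breakpoint [m] to [g], in agreement with [c 0 = true] for [g]:
    the new first piece is [[a, m[], and all the old pieces lie at or to the right of [m]. *)
Lemma piecewise_polynomial_cons (R : realType) (a m b v : R) (g : R -> R) :
  a < m -> piecewise_polynomial m b g ->
  piecewise_polynomial a b (fun x => if x < m then v else g x).
Proof.
move=> am [n [t [c [p [[t0 tn] [c0 cn] tlt gp]]]]].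
have mt i : (i <= n)%N -> m <= t i.
  elim: i => [|i IHi] ilen; first by rewrite t0.
  exact: le_trans (IHi (ltnW ilen)) (ltW (tlt _ ilen)).
exists n.+1, (fun i => if i is j.+1 then t j else a),
  (fun i => if i is j.+1 then c j else true),
  (fun i => if i is j.+1 then p j else v%:P).
split=> //.
- by case=> [_|i]; [rewrite t0|exact: tlt].
- case=> [_ x|i ilt x xi].
    by rewrite t0 c0 in_itv/= hornerC => /andP[_ ->].
  rewrite -(gp i ilt x xi) ltNge.
  suff -> : m <= x by [].
  apply: (le_trans (mt i (ltnW ilt))).
  move: xi; rewrite itv_boundlr => /andP[+ _].
  by case: (c i); rewrite bnd_simp// => /ltW.
Qed.

(** Induction on a bound for the number of pieces: a piece of length [h] is cut off on the left, and
    the induction hypothesis handles the rest. The left endpoint [a] moves, while [h] and [e] stay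
    fixed. *)
Lemma step_approx (R : realType) (b : R) (f : R -> R) (h e : R) (n : nat) (a : R) :
  0 < h -> a < b -> b - a <= h *+ n.+1 -> {within `[a, b], continuous f} ->
  (forall x, x \in `[a, b] -> 0 <= f x) ->
  (forall x y, x \in `[a, b] -> y \in `[a, b] ->
    `|x - y| <= h -> `|f x - f y| <= e) ->
  exists g : R -> R, [/\ piecewise_polynomial a b g,
    measurable_fun `[a, b] g,
    forall x, x \in `[a, b] -> 0 <= g x,
    (\int[lebesgue_measure]_(x in `[a, b]) (g x)%:E =
     \int[lebesgue_measure]_(x in `[a, b]) (f x)%:E)%E
    & forall x, x \in `[a, b] -> `|f x - g x| <= e].
Proof.
move=> h0.
have near_itv u v x y :
    v - u <= h -> x \in `[u, v] -> y \in `[u, v] -> `|x - y| <= h.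
  rewrite !in_itv/= => uv /andP[ux xv] /andP[uy yv].
  by rewrite ler_distl; lra.
elim: n a => [|n IHn] a ab abn cf f0 fh.
  have osc x y : x \in `[a, b] -> y \in `[a, b] -> `|f x - f y| <= e.
    by move=> abx aby; apply: fh => //; exact: near_itv abx aby.
  have [v [v0 vf fv]] := average_approx ab cf f0 osc.
  exists (cst v); split=> //; exact: piecewise_polynomial_cst.
(* If the interval is no longer than [h], then [a + h] is not interior to it and nothing can be cut
   off; the induction hypothesis applies to the whole interval. *)
have [abh|abh] := leP (b - a) h.
  apply: IHn => //; apply: (le_trans abh).
  by rewrite mulrS lerDl mulrn_wge0// ltW.
pose m := a + h.
have am : a < m by rewrite ltrDl.
have mb : m < b by rewrite -ltrBrDl.
have amb : {subset `[a, m] <= `[a, b]}.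
  by apply/subitvP; rewrite subitvE !bnd_simp/= ltW.
have mbb : {subset `[m, b] <= `[a, b]}.
  by apply/subitvP; rewrite subitvE !bnd_simp/= ltW.
have bmn : b - m <= h *+ n.+1.
  by move: abn; rewrite mulrS /m; lra.
have [|||g [gp mg g0 gf fg]] := IHn m mb bmn.
- exact: continuous_subspaceW cf.
- by move=> x /mbb; exact: f0.
- by move=> x y /mbb xb /mbb; exact: fh.
(* The average is taken over the closed [[a, m]], where compactness is available, although the piece
   itself is [[a, m[]. *)
have [|||v [v0 vf fv]] := @average_approx _ a m f e am.
- exact: continuous_subspaceW cf.
- by move=> x /amb; exact: f0.
- move=> x y xam yam; apply: fh; [exact: amb|exact: amb|].
  by apply: near_itv xam yam; rewrite /m addrC addKr.
have mf : measurable_fun `[a, b] f.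
  exact: subspace_continuous_measurable_fun.
pose k x := if x < m then v else g x.
have kv : {in `[a, m[%classic, cst v =1 k}.
  by move=> x; rewrite inE/= in_itv/= /k => /andP[_ ->].
have kg : {in `[m, b]%classic, g =1 k}.
  by move=> x; rewrite inE/= in_itv/= /k ltNge => /andP[->].
have abE : `[a, b]%classic = `[a, m[%classic `|` `[m, b]%classic.
  by apply: itv_bndbnd_setU; rewrite bnd_simp ltW.
have dsj : [disjoint `[a, m[%classic & `[m, b]%classic].
  apply: lt_disjoint => x y.
  by rewrite !in_itv/= => /andP[_ xm] /andP[my _]; exact: lt_le_trans my.
have mk : measurable_fun `[a, b] k.
  rewrite abE; apply/measurable_funU => //; split.
  - by apply: eq_measurable_fun kv _.
  - by apply: eq_measurable_fun kg _.
have splitab x : x \in `[a, b] ->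
    x \in `[a, m] /\ x < m \/ x \in `[m, b] /\ (x < m) = false.
  by rewrite !in_itv/= => /andP[-> ->]; case: ltP => [/ltW ->|_]; [left|right].
exists k; split.
- exact: piecewise_polynomial_cons.
- exact: mk.
- move=> x /splitab[[xam xm]|[xmb xm]]; rewrite /k xm//; exact: g0.
- have split_int (u : R -> R) : measurable_fun `[a, b] u ->
      (\int[lebesgue_measure]_(x in `[a, b]) (u x)%:E =
       \int[lebesgue_measure]_(x in `[a, m[) (u x)%:E +
       \int[lebesgue_measure]_(x in `[m, b]) (u x)%:E)%E.
    move=> mu; rewrite abE integral_setU// -abE; exact/measurable_EFinP.
  rewrite !split_int//; congr (_ + _)%E.
    (* The point [m] is null, so integrals over [[a, m[] and [[a, m]] agree; this transfers [vf] to
       the half-open piece. *)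
    rewrite [RHS]integral_itv_bndo_bndc -?vf; last first.
      apply/measurable_EFinP; apply: measurable_funS mf => //.
      by rewrite abE; exact: subsetUl.
    rewrite -integral_itv_bndo_bndc//.
    by apply: eq_integral => x /kv <-.
  by rewrite -gf; apply: eq_integral => x /kg <-.
- by move=> x /splitab[[xam xm]|[xmb xm]]; rewrite /k xm; [exact: fv|exact: fg].
Qed.

Theorem lemma3p1 (R : realType) (a b : R) (ab : a < b) (f : R -> R)
    (f_cont : {within `[a, b], continuous f})
    (f_density : prob_density a b f) (eps : R) (eps_gt0 : 0 < eps) :
  exists g : R -> R,
    [/\ piecewise_polynomial a b g,
        prob_density a b g
      & (sup_norm a b (f \- g)%R < eps%:E)%E].
Proof.
have [_ f0 f1] := f_density.
have e20 : 0 < eps / 2 by rewrite divr_gt0.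
have [h h0 fh] := within_continuous_uniform f_cont e20.
(* The integer part of [(b - a) / h], plus one, exceeds that quotient, so this many pieces of length
   [h] cover [[a, b]]. *)
have abh : b - a <= h *+ (Num.truncn ((b - a) / h)).+1.
  by rewrite -mulr_natr mulrC -ler_pdivrMr// ltW// truncnS_gt.
have [g [gp mg g0 gf fg]] := step_approx h0 ab abh f_cont f0 fh.
exists g; split=> //; first by split=> //; rewrite gf.
(* Pointwise bounds pass to the supremum only as a weak inequality; the choice of [eps / 2] makes
   the final one strict. *)
apply: (@le_lt_trans _ _ (eps / 2)%:E).
  by apply: ge_ereal_sup => _ [x abx <-]; rewrite lee_fin fg.
by rewrite lte_fin ltr_pdivrMr// ltr_pMr// ltr1n.
Qed.
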